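(* Consider the Poisson algebra $(\mathbb R[x,y],\cdot,\{\cdot,\cdot\})$ with $\{f,g\}=\frac{\partial f}{\partial x}\frac{\partial g}{\partial y}-\frac{\partial f}{\partial y}\frac{\partial g}{\partial x}$. A morphism of Poisson algebras $\alpha:\mathbb R[x,y]\to\mathbb R[x,y]$ which gives $(\mathbb R[x,y],\ \cdot_\alpha=\alpha\circ\cdot,\ \{\cdot,\cdot\}_\alpha=\alpha\circ\{\cdot,\cdot\},\ \alpha)$ a structure of Hom-Poisson algebra satisfies the equation $$1=\frac{\partial\alpha(x)}{\partial x}\frac{\partial\alpha(y)}{\partial y}-\frac{\partial\alpha(x)}{\partial y}\frac{\partial\alpha(y)}{\partial x}.$$
   Context: A morphism of Poisson algebras is a unital $\mathbb R$-algebra morphism $\alpha$ with $\alpha(\{f,g\})=\{\alpha(f),\alpha(g)\}$. A Hom-Poisson algebra $(A,\mu,\{\cdot,\cdot\},\alpha)$ consists of linear maps $\mu,\{\cdot,\cdot\}:A\otimes A\to A$, $\alpha:A\to A$, with $\alpha$ multiplicative for $\mu$ and $\{\cdot,\cdot\}$, such that $\mu$ is commutative and Hom-associative ($\mu(\mu(f,g),\alpha(h))=\mu(\alpha(f),\mu(g,h))$), $\{\cdot,\cdot\}$ is skew-symmetric and satisfies $\{\alpha(f),\{g,h\}\}+\{\alpha(g),\{h,f\}\}+\{\alpha(h),\{f,g\}\}=0$, and $\{\mu(f,g),\alpha(h)\}=\mu(\alpha(f),\{g,h\})+\mu(\{f,h\},\alpha(g))$. *)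

(* Defs.v *)
From mathcomp Require Import all_boot all_order all_algebra.
From mathcomp Require Import reals.
From mathcomp Require Import mpoly.

Set Implicit Arguments.
Unset Strict Implicit.
Unset Printing Implicit Defensive.

Import GRing.Theory.
Local Open Scope ring_scope.

(* Linear maps out of [A (x) A] are encoded as bilinear maps [A -> A -> A]. *)
Record is_hom_poisson (K : fieldType) (A : lmodType K)
    (mu br : A -> A -> A) (alpha : A -> A) : Prop := IsHomPoisson {
  hom_poisson_mul_linear_l : forall g, linear (mu^~ g);
  hom_poisson_mul_linear_r : forall f, linear (mu f);
  hom_poisson_br_linear_l : forall g, linear (br^~ g);
  hom_poisson_br_linear_r : forall f, linear (br f);
  hom_poisson_linear : linear alpha;
  hom_poisson_morph_mul : {morph alpha : f g / mu f g >-> mu f g};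
  hom_poisson_morph_br : {morph alpha : f g / br f g >-> br f g};
  hom_poisson_mulC : forall f g, mu f g = mu g f;
  hom_poisson_mulA : forall f g h, mu (mu f g) (alpha h) = mu (alpha f) (mu g h);
  hom_poisson_brC : forall f g, br f g = - br g f;
  hom_poisson_jacobi : forall f g h,
    br (alpha f) (br g h) + br (alpha g) (br h f) + br (alpha h) (br f g) = 0;
  hom_poisson_leibniz : forall f g h,
    br (mu f g) (alpha h) = mu (alpha f) (br g h) + mu (br f h) (alpha g)
}.

Definition poisson_morphism (K : fieldType) (A B : algType K)
    (brA : A -> A -> A) (brB : B -> B -> B)
    (alpha : {lrmorphism A -> B}) : Prop :=
  {morph alpha : f g / brA f g >-> brB f g}.

(* [{mpoly R[2]}] is R[x, y] with x the variable 0 and y the variable 1. *)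
Definition polyx (R : realType) : {mpoly R[2]} := 'X_ord0.
Definition polyy (R : realType) : {mpoly R[2]} := 'X_ord_max.

Definition dx (R : realType) (f : {mpoly R[2]}) : {mpoly R[2]} := f^`M(ord0).
Definition dy (R : realType) (f : {mpoly R[2]}) : {mpoly R[2]} := f^`M(ord_max).

Definition poisson_bracket (R : realType) (f g : {mpoly R[2]}) : {mpoly R[2]} :=
  dx f * dy g - dy f * dx g.

(* Main.v *)
Require Import Defs.
From mathcomp Require Import all_boot all_order all_algebra.
From mathcomp Require Import reals.
From mathcomp Require Import mpoly.

Local Open Scope ring_scope.

(** The coordinates are canonical: {x, y} = 1 ([poisson_bracket_xy]). A unital map preserving
    brackets sends this identity to 1 = {alpha(x), alpha(y)}, and the bracket on the right is by
    definition the Jacobian determinant of alpha. *)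

Lemma mderivXU (n : nat) (R : nzRingType) (i j : 'I_n) :
  ('X_i : {mpoly R[n]})^`M(j) = (i == j)%:R.
Proof.
rewrite mderivX mnm1E; have [->|_] := eqVneq i j; last by rewrite GRing.scale0r.
(* Subtraction of exponents is truncated; writing the minuend as [0 + U_(j)] lets [addmK] cancel it,
   leaving the constant monomial. *)
by rewrite -[X in (X - _)%MM]add0m addmK mpolyX0 GRing.scale1r.
Qed.

Lemma poisson_bracket_xy (R : realType) :
  poisson_bracket (polyx R) (polyy R) = 1.
Proof.
by rewrite /poisson_bracket /dx /dy !mderivXU /= GRing.mulr1 GRing.mulr0 GRing.subr0.
Qed.

Theorem proposition4p11 (R : realType)
    (alpha : {lrmorphism {mpoly R[2]} -> {mpoly R[2]}}) :
  poisson_morphism (@poisson_bracket R) (@poisson_bracket R) alpha ->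
  is_hom_poisson (fun f g : {mpoly R[2]} => alpha (f * g))
                 (fun f g : {mpoly R[2]} => alpha (poisson_bracket f g))
                 alpha ->
  1 = dx (alpha (polyx R)) * dy (alpha (polyy R))
      - dy (alpha (polyx R)) * dx (alpha (polyy R)).
Proof.
move=> morph_alpha _; have := morph_alpha (polyx R) (polyy R).
(* The rewritten hypothesis is the goal up to unfolding [poisson_bracket]. *)
by rewrite poisson_bracket_xy GRing.rmorph1.
Qed.
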